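(* Let $S$ be a finite set. The structure $(\mathcal{S}(\mathbb{N}^S),+,-,0,\mathbin{\&},\delta_\emptyset)$ is an $\mathbb{R}$-algebra (unital commutative associative algebra over $\mathbb{R}$), and it is naturally isomorphic (naturally in $S$) to the polynomial algebra $\mathbb{R}[S]$.
   Context: $\mathbb{N}^S$ is the set of functions $S\to\mathbb{N}$ (finite multisets over $S$), with multiset union $\uplus$ being pointwise addition; the empty multiset is the zero function and $\delta_\emptyset$ is the Dirac measure on it. $\mathcal{S}(\mathbb{N}^S)$ is the set of finite signed measures on the discrete space $\mathbb{N}^S$ with finite support, with pointwise vector space operations and multiplication $\mu\mathbin{\&}\nu=(\mu\otimes\nu)\circ\uplus^{-1}$, the pushforward of the product measure under $\uplus$. $\mathbb{R}[S]$ is the ring of polynomials in commuting indeterminates $S$. Naturality: there are $\mathbb{R}$-algebra isomorphisms $\phi_S:\mathbb{R}[S]\to\mathcal{S}(\mathbb{N}^S)$ for finite sets $S$ such that for every function $f:S\to T$ of finite sets, $\mathcal{S}(\mathbb{N}^f)\circ\phi_S=\phi_T\circ\mathbb{R}[f]$, where $\mathbb{R}[f]:\mathbb{R}[S]\to\mathbb{R}[T]$ substitutes $f(s)$ for $s$, and $\mathcal{S}(\mathbb{N}^f)$ is the pushforward of measures along the map $\mathbb{N}^S\to\mathbb{N}^T$ that replaces each occurrence of $s$ by $f(s)$ in a multiset, i.e. $m\mapsto\bigl(t\mapsto\sum_{f(s)=t}m(s)\bigr)$. *)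

(* Defs.v *)
From HB Require Import structures.
From mathcomp Require Import all_boot all_order all_algebra finmap.
From mathcomp Require Import monalg.
From mathcomp Require Import all_classical all_reals all_analysis.

Set Implicit Arguments.
Unset Strict Implicit.
Unset Printing Implicit Defensive.

Import Order.TTheory GRing.Theory Num.Theory.
Import numFieldNormedType.Exports.

Local Open Scope classical_set_scope.
Local Open Scope ring_scope.

Definition mset (S : finType) := {ffun S -> nat}.

Definition mset0 (S : finType) : mset S := [ffun=> 0%N].

Definition msetU (S : finType) (m n : mset S) : mset S :=
  [ffun s => m s + n s]%N.

Definition mset_map (S T : finType) (f : S -> T) (m : mset S) : mset T :=
  [ffun t => \sum_(s | f s == t) m s]%N.

HB.instance Definition _ (S : finType) := Countable.on (mset S).
HB.instance Definition _ (S : finType) := isPointed.Build (mset S) (mset0 S).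
HB.instance Definition _ (S : finType) :=
  @isMeasurable.Build default_measure_display (mset S) discrete_measurable
    discrete_measurable0 discrete_measurableC discrete_measurableU.

(* The product sigma-algebra on N^S x N^T is discrete too, as the spaces are
   countable. *)
Lemma measurable_mset_prod (S T : finType) (A : set (mset S * mset T)) :
  measurable A.
Proof.
have -> : A = \bigcup_(p in A) [set p] by rewrite bigcup_imset1 image_id.
rewrite bigcup_mkcond; apply: countable_bigcupT_measurable => [|p].
  exact: countableP.
case: ifPn => // _; rewrite (_ : [set p] = [set p.1] `*` [set p.2]).
  exact: measurableX.
by case: p => x y; apply/seteqP; split=> [[a b] [-> ->]|[a b] [/= -> ->]].
Qed.

Section Charges.
Context (R : realType).
Local Open Scope ereal_scope.

(* A [charge] is a finite signed measure: countably additive, with finite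
   values. On a discrete space, the support is the set of atoms. *)
Record fsmeasure (S : finType) := FSMeasure {
  fsm_charge :> {charge set (mset S) -> \bar R};
  fsm_finite_support : finite_set [set m | fsm_charge [set m] != 0] }.

Definition fsm_support (S : finType) (mu : fsmeasure S) : set (mset S) :=
  [set m | mu [set m] != 0].

Lemma fsm_ext (S : finType) (mu nu : fsmeasure S) :
  (forall A, mu A = nu A) -> mu = nu.
Proof.
move: mu nu => [[f cf] sf] [[g cg] sg] /= /funext fg; subst g.
have E : cf = cg.
  case: cf cg {sf sg} => [[a] [b] [c]] [[a'] [b'] [c']].
  by congr (Charge.Class _ _ _); congr (_ _); apply: Prop_irrelevance.
by subst cg; congr FSMeasure; apply: Prop_irrelevance.
Qed.

Lemma fsm_outside (S : finType) (mu : fsmeasure S) (A : set (mset S)) :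
  A `&` fsm_support mu = set0 -> mu A = 0.
Proof.
move=> A0.
pose F n := [set m : mset S | A m /\ choice.pickle m = n].
have F0 n : mu (F n) = 0.
  have [[m [Am mn]]|Fn0] := pselect (exists m, F n m).
    have -> : F n = [set m].
      apply/seteqP; split=> [x [_ xn]|_ ->] //=.
      by apply: (pcan_inj choice.pickleK); rewrite xn mn.
    apply: contrapT => /eqP m0; suff : (A `&` fsm_support mu) m by rewrite A0.
    by [].
  rewrite (_ : F n = set0) ?charge0//.
  by apply/seteqP; split=> [x Fx|x []]; apply: Fn0; exists x.
have AF : A = \bigcup_n F n.
  apply/seteqP; split=> [m Am|m [n _ []]//]; by exists (choice.pickle m).
have tF : trivIset setT F.
  apply/trivIsetP => i j _ _ /eqP ij; apply/seteqP.
  by split=> [x [[_ xi] [_ xj]]|x []]//; apply: ij; rewrite -xi.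
have := @charge_semi_sigma_additive _ _ _ mu F (fun _ => I) tF I.
rewrite -AF (_ : (fun _ => _) = cst 0).
  by move=> /(cvg_unique (@ereal_hausdorff R))/(_ (cvg_cst _)).
by apply/funext => n; rewrite big1.
Qed.

Lemma charge_seqE (S : finType) (nu : {charge set (mset S) -> \bar R})
    (r : seq (mset S)) : uniq r ->
  nu [set` r] = \sum_(x <- r) nu [set x].
Proof.
elim: r => [|x r IH] /=; first by rewrite big_nil set_nil charge0.
move=> /andP[xr ur]; rewrite big_cons -IH// -chargeU//.
  by congr (nu _); apply/seteqP; split=> y /=; rewrite inE;
    [move=> /orP[/eqP|]; [left|right]|move=> [->|->]; rewrite ?eqxx ?orbT].
by apply/seteqP; split=> [y [/= -> yr]|//]; move: xr; rewrite yr.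
Qed.

(* A finitely supported signed measure is determined by its point masses. *)
Lemma fsmE (S : finType) (mu : fsmeasure S) (A : set (mset S)) :
  mu A = \sum_(m \in A) mu [set m].
Proof.
have fA : finite_set (A `&` fsm_support mu).
  exact: sub_finite_set (@subIsetr _ _ _) (fsm_finite_support mu).
have -> : mu A = mu (A `&` fsm_support mu).
  rewrite [LHS](chargeDI _ _ (I : measurable (fsm_support mu)))//.
  by rewrite (fsm_outside (A := A `\` _)) ?add0e// setDE -setIA setICl setI0.
have [r ur Er] : exists2 r : seq (mset S),
    uniq r & A `&` fsm_support mu = [set` r].
  by exists (fset_set (A `&` fsm_support mu)); rewrite ?fset_uniq// fset_setK.
rewrite Er charge_seqE// fsbig_seq// -Er.
apply: fsbig_widen; first exact: subIsetl.
by move=> m [Am /not_andP[//|/negP]]; rewrite negbK => /eqP.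
Qed.

Lemma charge_sum_dirac d (T : measurableType d) (g : T -> R) (r : seq T) :
  exists nu : {charge set T -> \bar R},
    forall A, nu A = \sum_(x <- r) (g x)%:E * \d_x A.
Proof.
elim: r => [|x r [nu IH]].
  by exists czero => A; rewrite big_nil.
exists (cadd (cscale (g x) (charge_of_finite_measure \d_x)) nu) => A.
by rewrite big_cons -IH.
Qed.

Lemma fsm0_subproof (S : finType) :
  finite_set [set m : mset S | (czero [set m] : \bar R) != 0].
Proof.
by rewrite (_ : mkset _ = set0)//; apply/seteqP; split=> // m /=; rewrite eqxx.
Qed.
Definition fsm0 (S : finType) : fsmeasure S :=
  FSMeasure (fsm_charge := czero) (fsm0_subproof S).

Lemma fsmD_subproof (S : finType) (mu nu : fsmeasure S) :
  finite_set [set m | cadd mu nu [set m] != 0].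
Proof.
apply: sub_finite_set (_ : finite_set (fsm_support mu `|` fsm_support nu)).
  move=> m /= mn0; apply/orP; rewrite -negb_and; apply: contra mn0.
  by move=> /andP[/eqP m0 /eqP n0]; rewrite /cadd m0 n0 adde0.
by rewrite finite_setU; split; exact: fsm_finite_support.
Qed.
Definition fsmD (S : finType) (mu nu : fsmeasure S) : fsmeasure S :=
  FSMeasure (fsmD_subproof mu nu).

Lemma fsmN_subproof (S : finType) (mu : fsmeasure S) :
  finite_set [set m | copp mu [set m] != 0].
Proof.
by apply: sub_finite_set (fsm_finite_support mu) => m /=; rewrite /copp oppe_eq0.
Qed.
Definition fsmN (S : finType) (mu : fsmeasure S) : fsmeasure S :=
  FSMeasure (fsmN_subproof mu).

Lemma fsmZ_subproof (S : finType) (c : R) (mu : fsmeasure S) :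
  finite_set [set m | cscale c mu [set m] != 0].
Proof.
apply: sub_finite_set (fsm_finite_support mu) => m /=.
by apply: contra => /eqP m0; rewrite /cscale m0 mule0.
Qed.
Definition fsmZ (S : finType) (c : R) (mu : fsmeasure S) : fsmeasure S :=
  FSMeasure (fsmZ_subproof c mu).

Lemma fsm1_subproof (S : finType) : finite_set
  [set m | charge_of_finite_measure (\d_(mset0 S) : set (mset S) -> \bar R)
             [set m] != 0].
Proof.
apply: sub_finite_set (finite_set1 (mset0 S)) => m /=.
rewrite /charge_of_finite_measure diracE; apply: contraNP => /eqP m0.
by rewrite memNset//= => /esym/eqP; exact/negP.
Qed.
Definition fsm1 (S : finType) : fsmeasure S :=
  FSMeasure (fsm1_subproof S).

Section Product.
Variables (S T : finType) (mu : fsmeasure S) (nu : fsmeasure T).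

(* [fsm_prodX] below is the characteristic property of the product measure. *)
Definition fsm_prod (A : set (mset S * mset T)) : \bar R :=
  \sum_(p \in A) mu [set p.1] * nu [set p.2].

Let supp := fsm_support mu `*` fsm_support nu.

Let finite_supp : finite_set supp.
Proof. by apply: finite_setX; exact: fsm_finite_support. Qed.

Let out_supp p : ~ supp p -> mu [set p.1] * nu [set p.2] = 0.
Proof.
move=> /not_andP[|] /negP; rewrite negbK => /eqP ->; by rewrite ?mul0e ?mule0.
Qed.

Let fsm_prod_charge : exists la : {charge set (mset S * mset T)%type -> \bar R},
  fsm_prod = la.
Proof.
pose g p := fine (mu [set p.1] * nu [set p.2]).
have [la laE] := charge_sum_dirac g (fset_set supp).
exists la; apply/funext => A; rewrite laE /fsm_prod.
rewrite fsbig_mkcond -(fsbig_widen supp setT)//; last first.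
  by move=> p [_ Np] /=; rewrite /patch out_supp// if_same.
rewrite fsbig_finite//; apply: eq_bigr => p _.
rewrite /patch diracE /g fineK; last by rewrite fin_numM// fin_num_measure.
by case: ifP; rewrite ?mule1 ?mule0.
Qed.

Let fsm_prod0 : fsm_prod set0 = 0.
Proof. by have [la ->] := fsm_prod_charge; rewrite charge0. Qed.

Let fsm_prod_fin A : measurable A -> fsm_prod A \is a fin_num.
Proof. by have [la ->] := fsm_prod_charge; exact: fin_num_measure. Qed.

Let fsm_prod_sigma_additive : semi_sigma_additive fsm_prod.
Proof.
by have [la ->] := fsm_prod_charge; exact: charge_semi_sigma_additive.
Qed.

HB.instance Definition _ := isCharge.Build _ _ _ fsm_prod
  fsm_prod0 fsm_prod_fin fsm_prod_sigma_additive.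

Lemma fsm_prodX (A : set (mset S)) (B : set (mset T)) :
  fsm_prod (A `*` B) = mu A * nu B.
Proof.
pose r := fset_set (fsm_support mu); pose t := fset_set (fsm_support nu).
have inr x : (x \in r) = (mu [set x] != 0).
  rewrite /r in_fset_set; last exact: fsm_finite_support.
  by apply/idP/idP; rewrite inE.
have int x : (x \in t) = (nu [set x] != 0).
  rewrite /t in_fset_set; last exact: fsm_finite_support.
  by apply/idP/idP; rewrite inE.
have fsE (U : choiceType) (s : seq U) (C : set U) (f : U -> \bar R) : uniq s ->
    (forall i, i \notin s -> f i = 0) ->
    \sum_(i \in C) f i = \sum_(i <- s | i \in C) f i.
  by move=> us f0; rewrite [RHS]bigfs ?set_mem_set// => i _; exact: f0.
rewrite (fsmE mu) (fsmE nu) /fsm_prod.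
rewrite (fsE _ r) ?fset_uniq//; last by move=> x; rewrite inr negbK => /eqP.
rewrite (fsE _ t) ?fset_uniq//; last by move=> x; rewrite int negbK => /eqP.
rewrite (fsE _ [seq (x, y) | x <- r, y <- t]); first last.
- move=> -[x y]; apply: contraNeq => /=; rewrite mule_eq0 negb_or.
  by move=> /andP[x0 y0]; apply/allpairsP; exists (x, y); rewrite inr int.
- by apply: allpairs_uniq; rewrite ?fset_uniq// => -[? ?] [].
rewrite [RHS](_ : _ = ((\sum_(x <- r | x \in A) fine (mu [set x])) *
    (\sum_(y <- t | y \in B) fine (nu [set y])))%:E); last first.
  rewrite EFinM -!sumEFin; congr (_ * _);
  by apply: eq_bigr => x _; rewrite fineK// fin_num_measure.
rewrite big_distrlr/= -sumEFin big_mkcond/= big_allpairs [RHS]big_mkcond/=.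
apply: eq_bigr => x _.
have [xA|xA] := boolP (x \in A); last first.
  apply: big1 => y _; case: ifPn => // /set_mem[/= Ax].
  by rewrite (mem_set Ax) in xA.
rewrite -sumEFin [RHS]big_mkcond/=; apply: eq_bigr => y _.
have -> : ((x, y) \in A `*` B) = (y \in B).
  by apply/idP/idP => [/set_mem[_ /mem_set]//|/set_mem yB];
    apply/mem_set; split=> //; exact: set_mem.
by case: ifP => // _; rewrite EFinM !fineK ?fin_num_measure.
Qed.

Lemma fsm_prod_outside (A : set (mset S * mset T)) :
  A `&` (fsm_support mu `*` fsm_support nu) = set0 -> fsm_prod A = 0.
Proof.
move=> A0; apply: fsbig1 => p Ap; apply: out_supp => sp.
by have : (A `&` supp) p by []; rewrite A0.
Qed.

End Product.

(* The library instance making [pushforward nu f] a charge cannot be inferred,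
   as it depends on the measurability of [f]. *)
Definition charge_pushforward d1 d2 (T1 : measurableType d1)
    (T2 : measurableType d2) (f : T1 -> T2) (mf : measurable_fun setT f)
    (nu : {charge set T1 -> \bar R}) : {charge set T2 -> \bar R} :=
  measure_function_pushforward__canonical__charge_Charge nu mf.

Definition msetU_pair (S : finType) (p : mset S * mset S) : mset S :=
  msetU p.1 p.2.

Lemma measurable_msetU_pair (S : finType) :
  measurable_fun setT (@msetU_pair S).
Proof. by move=> _ A _; exact: measurable_mset_prod. Qed.

Lemma measurable_mset_map (S T : finType) (f : S -> T) :
  measurable_fun setT (mset_map f).
Proof. by []. Qed.

Lemma fsmM_subproof (S : finType) (mu nu : fsmeasure S) :
  finite_set [set m |
    charge_pushforward (@measurable_msetU_pair S) (fsm_prod mu nu) [set m] != 0].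
Proof.
apply: (sub_finite_set (B := (@msetU_pair S) @`
    (fsm_support mu `*` fsm_support nu))); last first.
  by apply/finite_image/finite_setX; exact: fsm_finite_support.
move=> m /=; apply: contraNP => Nm; apply/eqP/fsm_prod_outside.
by apply/seteqP; split=> // p [/= pm sp]; apply: Nm; exists p.
Qed.
Definition fsmM (S : finType) (mu nu : fsmeasure S) : fsmeasure S :=
  FSMeasure (fsmM_subproof mu nu).

Lemma fsm_map_subproof (S T : finType) (f : S -> T) (mu : fsmeasure S) :
  finite_set [set m |
    charge_pushforward (@measurable_mset_map S T f) mu [set m] != 0].
Proof.
apply: (sub_finite_set (B := mset_map f @` fsm_support mu)); last first.
  exact/finite_image/fsm_finite_support.
move=> m /=; apply: contraNP => Nm; apply/eqP/fsm_outside.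
by apply/seteqP; split=> // p [/= pm sp]; apply: Nm; exists p.
Qed.
Definition fsm_map (S T : finType) (f : S -> T) (mu : fsmeasure S) :
    fsmeasure T :=
  FSMeasure (fsm_map_subproof f mu).

End Charges.
Arguments fsm0 {R S}.
Arguments fsm1 {R S}.

Section ExplicitAlgebra.
Variables (R : comNzRingType) (V : Type).
Variables (add : V -> V -> V) (opp : V -> V) (zero : V) (scale : R -> V -> V).
Variables (mul : V -> V -> V) (one : V).

Record is_com_algebra : Prop := IsComAlgebra {
  ca_addA : associative add;
  ca_addC : commutative add;
  ca_add0 : left_id zero add;
  ca_addN : left_inverse zero opp add;
  ca_scaleA : forall a b v, scale a (scale b v) = scale (a * b) v;
  ca_scale1 : left_id 1 scale;
  ca_scaleDr : right_distributive scale add;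
  ca_scaleDl : forall v, {morph scale^~ v : a b / a + b >-> add a b};
  ca_mulA : associative mul;
  ca_mulC : commutative mul;
  ca_mul1 : left_id one mul;
  ca_mulDl : left_distributive mul add;
  ca_scaleAl : forall a u v, scale a (mul u v) = mul (scale a u) v }.

Record is_algebra_iso (A : comAlgType R) (phi : A -> V) : Prop := IsAlgebraIso {
  ai_add : {morph phi : p q / p + q >-> add p q};
  ai_scale : forall c, {morph phi : p / c *: p >-> scale c p};
  ai_mul : {morph phi : p q / p * q >-> mul p q};
  ai_one : phi 1 = one;
  ai_bij : bijective phi }.

End ExplicitAlgebra.

(* R[S]: [{malg R[K]}] is the monoid algebra of K, and [{cmonom S}] is the
   monoid of commutative monomials with indeterminates in S. *)
Definition mpoly_on (R : comNzRingType) (S : finType) : comAlgType R :=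
  {malg R[{cmonom S}]}.

Definition mpoly_var (R : comNzRingType) (S : finType) (s : S) : mpoly_on R S :=
  << ucm s >>%R.

(* R[f]: the substitution of the variable f(s) for each variable s. *)
Definition mpoly_map (R : comNzRingType) (S T : finType) (f : S -> T)
    (p : mpoly_on R S) : mpoly_on R T :=
  mmap (fun c : R => c%:A : mpoly_on R T)
       (fun m : {cmonom S} => \prod_(s : S) mpoly_var R (f s) ^+ m s) p.

(* Main.v *)
(* The isomorphism sends a polynomial to the combination of the Dirac measures
   at its monomials, with its coefficients as weights. The value of this measure
   on a set A is linear in the polynomial (it is the sum of the coefficients of
   the monomials in A), and the coefficients are recovered from the point
   masses. The algebra laws of the measures are then transported from the
   polynomials. *)
Require Import Defs.
From mathcomp Require Import all_boot all_order all_algebra.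
From mathcomp Require Import finmap monalg.
From mathcomp Require Import all_classical all_reals all_analysis.

Set Implicit Arguments.
Unset Strict Implicit.
Unset Printing Implicit Defensive.

Import GRing.Theory Num.Theory.

Local Open Scope classical_set_scope.
Local Open Scope ring_scope.

Local Notation mset := Defs.mset.

(** * Transport of the algebra laws along an isomorphism *)

(** Since [phi] is onto, every element of [V] can be written as an image; each law then becomes the
    image of the same law in [A]. The hypotheses on zero and opposite supply what [is_algebra_iso]
    does not record. *)
Lemma com_algebra_of_iso (R : comNzRingType) (A : comAlgType R) (V : Type)
    (add : V -> V -> V) (opp : V -> V) (zero : V) (scale : R -> V -> V)
    (mul : V -> V -> V) (one : V) (phi : A -> V) :
  is_algebra_iso add scale mul one phi ->
  phi 0 = zero -> {morph phi : p / - p >-> opp p} ->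
  is_com_algebra add opp zero scale mul one.
Proof.
move=> [phiD phiZ phiM phi1 [psi _ psiK]] phi0 phiN.
have phiP v : exists p, v = phi p by exists (psi v).
split.
- move=> u v w; have [[p ->] [q ->] [r ->]] := And3 (phiP u) (phiP v) (phiP w).
  by rewrite -!phiD addrA.
- move=> u v; have [[p ->] [q ->]] := (phiP u, phiP v).
  by rewrite -!phiD addrC.
- by move=> u; have [p ->] := phiP u; rewrite -phi0 -phiD add0r.
- by move=> u; have [p ->] := phiP u; rewrite -phiN -phiD addNr.
- by move=> a b u; have [p ->] := phiP u; rewrite -!phiZ scalerA.
- by move=> u; have [p ->] := phiP u; rewrite -phiZ scale1r.
- move=> a u v; have [[p ->] [q ->]] := (phiP u, phiP v).
  by rewrite -phiD -!phiZ -phiD scalerDr.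
- move=> u a b; have [p ->] := phiP u.
  by rewrite -!phiZ -phiD scalerDl.
- move=> u v w; have [[p ->] [q ->] [r ->]] := And3 (phiP u) (phiP v) (phiP w).
  by rewrite -!phiM mulrA.
- move=> u v; have [[p ->] [q ->]] := (phiP u, phiP v).
  by rewrite -!phiM mulrC.
- by move=> u; have [p ->] := phiP u; rewrite -phi1 -phiM mul1r.
- move=> u v w; have [[p ->] [q ->] [r ->]] := And3 (phiP u) (phiP v) (phiP w).
  by rewrite -phiD -!phiM -phiD mulrDl.
- move=> a u v; have [[p ->] [q ->]] := (phiP u, phiP v).
  by rewrite -phiM -!phiZ -phiM scalerAl.
Qed.

(** * Monomials and multisets as isomorphic monoids *)

Section MonomialsAsMultisets.
Variable S : finType.

Definition mset_of (k : {cmonom S}) : mset S := [ffun s => k s].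

(** A monomial has finite support, so a finite domain must be given; taking all of [S] keeps every
    value of [m]. *)
Definition cmonom_of (m : mset S) : {cmonom S} :=
  [cmonom m s | s in [fset s | s in S]%fset]%M.

Lemma cmonom_ofE m s : cmonom_of m s = m s.
Proof. by rewrite cmE fsfun_fun in_fsetE inE. Qed.

Lemma mset_ofK : cancel mset_of cmonom_of.
Proof. by move=> k; apply/eqP/cmP => s; rewrite cmonom_ofE ffunE. Qed.

Lemma cmonom_ofK : cancel cmonom_of mset_of.
Proof. by move=> m; apply/ffunP => s; rewrite ffunE cmonom_ofE. Qed.

Lemma mset_of1 : mset_of (@mone _) = mset0 S.
Proof. by apply/ffunP => s; rewrite !ffunE cm1. Qed.

Lemma mset_ofM (k l : {cmonom S}) :
  mset_of (mmul k l) = msetU (mset_of k) (mset_of l).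
Proof. by apply/ffunP => s; rewrite !ffunE cmM. Qed.

Lemma cmonom_prodE (I : finType) (a : I -> {cmonom S}) s :
  (\big[@mmul _/@mone _]_i a i) s = (\sum_i a i s)%N.
Proof.
by apply: (big_morph (fun k : {cmonom S} => k s)) => [k l|]; rewrite (cmM, cm1).
Qed.

Lemma cmonom_expE (k : {cmonom S}) n s : iter n (mmul k) (@mone _) s = (n * k s)%N.
Proof. by elim: n => [|n IH]; rewrite ?cm1//= cmM IH. Qed.

End MonomialsAsMultisets.

(** * Products of monomials in the monoid algebra *)

Section MonomialsInTheAlgebra.
Variables (R : comNzRingType) (K : conomType).

Lemma malgUM (k l : K) : << (mmul k l) >> = << k >> * << l >> :> {malg R[K]}.
Proof. by rewrite malgME !msuppU1 !big_seq_fset1 !mcoeffUU mulr1. Qed.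

Lemma malgUX (k : K) n : << iter n (mmul k) (@mone _) >> = << k >> ^+ n :> {malg R[K]}.
Proof. by elim: n => [|n IH]; rewrite ?expr0// exprS -IH -malgUM. Qed.

Lemma malgU_prod (I : finType) (a : I -> K) :
  << \big[@mmul _/@mone _]_i a i >> = \prod_i << a i >> :> {malg R[K]}.
Proof. by apply: (big_morph (fun k : K => << k >>)) => // k l; apply: malgUM. Qed.

End MonomialsInTheAlgebra.

(** Substitution sends a monomial to a single monomial, in which the exponent of [t] collects those
    of all [s] over [t]. Naturality rests on this. *)
Lemma mpoly_prod_var (R : comNzRingType) (S T : finType) (f : S -> T)
    (k : {cmonom S}) :
  \prod_(s : S) mpoly_var R (f s) ^+ k s =
  << cmonom_of (mset_map f (mset_of k)) >> :> mpoly_on R T.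
Proof.
(* The product is moved inside the monoid, where monomials can be compared exponent by exponent. *)
transitivity (<< \big[@mmul _/@mone _]_s iter (k s) (mmul (ucm (f s))) (@mone _) >>
    : {malg R[{cmonom T}]}).
  by rewrite malgU_prod; apply: eq_bigr => s _; rewrite malgUX.
congr (<< _ >>); apply/eqP/cmP => t.
rewrite cmonom_prodE cmonom_ofE !ffunE [RHS]big_mkcond; apply: eq_bigr => s _.
by rewrite cmonom_expE cmU ffunE; case: eqP; rewrite ?muln1 ?muln0.
Qed.

(** * The measure of a polynomial and its values on sets *)

Section FromPolynomials.
Variables (R : realType) (S : finType).
Implicit Types (p q : mpoly_on R S) (A : set (mset S)) (m : mset S).

Lemma fsm_dirac_subproof m : finite_set
  [set n | charge_of_finite_measure (\d_m : set (mset S) -> \bar R) [set n] != 0%E].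
Proof.
apply: sub_finite_set (finite_set1 m) => n /=.
rewrite /charge_of_finite_measure diracE; apply: contraNP => /eqP nm.
by rewrite memNset//= => /esym/eqP; exact/negP.
Qed.

Definition fsm_dirac m : fsmeasure R S := FSMeasure (fsm_dirac_subproof m).

(** The sum is a bare iteration of [fsmD]: the algebra laws of measures are only derived later, from
    this very map. *)
Definition fsm_of_mpoly p : fsmeasure R S :=
  \big[@fsmD R S/fsm0]_(k <- msupp p) fsmZ p@_k (fsm_dirac (mset_of k)).

Definition mpoly_mass A p : R :=
  mmap idfun (fun k => (mset_of k \in A)%:R) p.

(** With [fsm_ext], this reduces an identity between measures to one between real numbers for each
    [A]. *)
Lemma fsm_of_mpolyE p A : fsm_of_mpoly p A = (mpoly_mass A p)%:E.
Proof.
rewrite /fsm_of_mpoly /mpoly_mass mmapE -sumEFin.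
elim: (enum_fset (msupp p)) => [|k r IH]; first by rewrite !big_nil.
by rewrite !big_cons -IH EFinM -diracE.
Qed.

Lemma mpoly_massD A p q : mpoly_mass A (p + q) = mpoly_mass A p + mpoly_mass A q.
Proof. exact: mmapD. Qed.

Lemma mpoly_massZ A c p : mpoly_mass A (c *: p) = c * mpoly_mass A p.
Proof.
(* The support of [c *: p] may be smaller than that of [p], as for [c = 0], so both sums are taken
   over the latter. *)
rewrite /mpoly_mass (mmapEw (msuppZ_le c p)) mmapE mulr_sumr.
by apply: eq_bigr => k _; rewrite /= mcoeffZ mulrA.
Qed.

Lemma mpoly_mass_sum A (I : Type) (r : seq I) (F : I -> mpoly_on R S) :
  mpoly_mass A (\sum_(i <- r) F i) = \sum_(i <- r) mpoly_mass A (F i).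
Proof.
apply: big_morph => [p q|]; first exact: mpoly_massD.
by rewrite -(scale0r 0) mpoly_massZ mul0r.
Qed.

Lemma mpoly_massU A c k :
  mpoly_mass A << c *g k >> = c * (mset_of k \in A)%:R.
Proof. exact: mmapU. Qed.

(** Exactly one monomial has its multiset in a singleton. Hence the measure determines the
    coefficients, which gives injectivity. *)
Lemma mpoly_mass_set1 p m : mpoly_mass [set m] p = p@_(cmonom_of m).
Proof.
rewrite [in RHS](monalgE p) raddf_sum; apply: eq_bigr => k _.
rewrite /= mcoeffU -(can2_eq (@mset_ofK S) (@cmonom_ofK S)) mulr_natr.
by congr (_ *+ nat_of_bool _); apply/idP/eqP => [/set_mem//|<-]; exact: mem_set.
Qed.

End FromPolynomials.

(** Every pair of nonzero weight lies in the grid of [r] and [t], so the sum over [B] becomes a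
    double sum, the shape of a product of polynomials. *)
Lemma fsm_prod_seq (R : realType) (S T : finType) (mu : fsmeasure R S)
    (nu : fsmeasure R T) (r : seq (mset S)) (t : seq (mset T))
    (B : set (mset S * mset T)) :
  uniq r -> uniq t -> (forall x, x \notin r -> mu [set x] = 0%E) ->
  (forall y, y \notin t -> nu [set y] = 0%E) ->
  fsm_prod mu nu B = (\sum_(x <- r) \sum_(y <- t)
    mu [set x] * nu [set y] * ((x, y) \in B)%:R%:E)%E.
Proof.
move=> ur ut mu0 nu0; rewrite /fsm_prod -[B in LHS]set_mem_set.
rewrite -(@bigfs _ _ _ _ [seq (x, y) | x <- r, y <- t]).
- rewrite big_mkcond big_allpairs; apply: eq_bigr => x _; apply: eq_bigr => y _ /=.
  by rewrite -[in_set B _]/((x, y) \in B); case: ifP; rewrite ?mule1 ?mule0.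
- by apply: allpairs_uniq => // -[? ?] [].
- move=> [x y] _ /=; apply: contraNeq; rewrite mule_eq0 negb_or => /andP[x0 y0].
  apply/allpairsP; exists (x, y); split=> //=; apply: contraT.
    by move=> /mu0 /eqP; rewrite (negbTE x0).
  by move=> /nu0 /eqP; rewrite (negbTE y0).
Qed.

(** * The isomorphism for a fixed set of indeterminates *)

Section Isomorphism.
Variables (R : realType) (S : finType).
Implicit Types (p q : mpoly_on R S) (A : set (mset S)) (mu : fsmeasure R S).
Local Notation phi := (@fsm_of_mpoly R S).

Lemma fsm_of_mpolyD : {morph phi : p q / p + q >-> fsmD p q}.
Proof.
move=> p q; apply: fsm_ext => A.
by rewrite fsm_of_mpolyE mpoly_massD EFinD -!fsm_of_mpolyE.
Qed.

Lemma fsm_of_mpolyZ c : {morph phi : p / c *: p >-> fsmZ c p}.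
Proof.
move=> p; apply: fsm_ext => A.
by rewrite fsm_of_mpolyE mpoly_massZ EFinM -!fsm_of_mpolyE.
Qed.

Lemma fsm_of_mpoly0 : phi 0 = fsm0.
Proof.
apply: fsm_ext => A.
by rewrite -[X in phi X](scale0r 0) fsm_of_mpolyE mpoly_massZ mul0r.
Qed.

Lemma fsm_of_mpolyN : {morph phi : p / - p >-> fsmN p}.
Proof.
move=> p; apply: fsm_ext => A.
by rewrite -scaleN1r fsm_of_mpolyE mpoly_massZ mulN1r EFinN -!fsm_of_mpolyE.
Qed.

Lemma fsm_of_mpoly1 : phi 1 = fsm1.
Proof.
apply: fsm_ext => A.
by rewrite fsm_of_mpolyE mpoly_massU mul1r mset_of1 -diracE.
Qed.

Lemma fsm_of_mpoly_set1 p (m : mset S) : phi p [set m] = (p@_(cmonom_of m))%:E.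
Proof. by rewrite fsm_of_mpolyE mpoly_mass_set1. Qed.

Lemma fsm_of_mpolyM : {morph phi : p q / p * q >-> fsmM p q}.
Proof.
move=> p q; apply: fsm_ext => A.
pose supp (p : mpoly_on R S) := [seq mset_of k | k <- msupp p].
have supp_uniq p' : uniq (supp p').
  by rewrite map_inj_uniq ?fset_uniq//; exact: can_inj (@mset_ofK S).
have supp0 p' m : m \notin supp p' -> phi p' [set m] = 0%E.
  move=> mp; rewrite fsm_of_mpoly_set1 mcoeff_outdom//.
  by apply: contra mp => mp; apply/mapP; exists (cmonom_of m); rewrite ?cmonom_ofK.
(* By definition the right side is the product measure of the preimage of [A] under [msetU_pair]. *)
rewrite [RHS](fsm_prod_seq _ (supp_uniq p) (supp_uniq q) (supp0 p) (supp0 q)).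
rewrite fsm_of_mpolyE malgME mpoly_mass_sum -sumEFin big_map; apply: eq_bigr => k _.
rewrite mpoly_mass_sum -sumEFin big_map; apply: eq_bigr => l _.
rewrite mpoly_massU !fsm_of_mpoly_set1 !mset_ofK !EFinM.
by rewrite mset_ofM.
Qed.

Lemma fsm_of_mpoly_bij : bijective phi.
Proof.
(* The inverse takes the point masses as coefficients. *)
pose psi mu : mpoly_on R S := \sum_(m <- fset_set (fsm_support mu))
  << fine (mu [set m]) *g cmonom_of m >>.
have psiK : cancel psi phi.
  move=> mu; apply: fsm_ext => A; rewrite !fsmE; apply: eq_fsbigr => m _.
  rewrite fsm_of_mpoly_set1 raddf_sum /=.
  under eq_bigr do rewrite mcoeffU (can_eq (@cmonom_ofK S)).
  have finm : (fine (mu [set m]))%:E = mu [set m] by rewrite fineK// fin_num_measure.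
  (* Only the term indexed by [m] can contribute; if [m] is outside the support, there is no such
     term and the mass of [m] is zero too. *)
  have [mm|mm] := boolP (m \in fset_set (fsm_support mu)).
    rewrite (big_fsetD1 m)//= eqxx mulr1n big1_fset ?addr0// => n.
    by rewrite in_fsetD1 => /andP[/negbTE ->].
  rewrite big1_fset => [|n nm _]; last by case: eqP nm mm => // -> ->.
  move: mm; rewrite in_fset_set; last exact: fsm_finite_support.
  by move=> /negP mm; apply/esym/eqP/negPn/negP => m0; apply: mm; exact: mem_set.
have phi_inj : injective phi.
  move=> p q pq; apply/malgP => k; rewrite -[k]mset_ofK; apply: EFin_inj.
  by rewrite -!fsm_of_mpoly_set1 pq.
by exists psi => //; exact: inj_can_sym psiK phi_inj.
Qed.

Lemma fsm_of_mpoly_iso :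
  is_algebra_iso (@fsmD R S) (@fsmZ R S) (@fsmM R S) (@fsm1 R S) phi.
Proof.
split; [exact: fsm_of_mpolyD|exact: fsm_of_mpolyZ|exact: fsm_of_mpolyM
  |exact: fsm_of_mpoly1|exact: fsm_of_mpoly_bij].
Qed.

End Isomorphism.

(** * Naturality *)

(** On a set [A], both sides add the coefficients of the monomials of [p] whose multiset is mapped
    into [A] by [mset_map f]. *)
Lemma fsm_map_of_mpoly (R : realType) (S T : finType) (f : S -> T)
    (p : mpoly_on R S) :
  fsm_map f (fsm_of_mpoly p) = fsm_of_mpoly (mpoly_map f p).
Proof.
apply: fsm_ext => A; rewrite [RHS]fsm_of_mpolyE.
rewrite [LHS](fsm_of_mpolyE p (mset_map f @^-1` A)); congr EFin.
rewrite [mpoly_map f p]mmapE mpoly_mass_sum; apply: eq_bigr => k _.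
rewrite mpoly_prod_var -scalerAl mul1r mpoly_massZ mpoly_massU.
by rewrite mul1r cmonom_ofK.
Qed.

Theorem lemma2p2 (R : realType) :
  (forall S : finType,
     is_com_algebra (@fsmD R S) (@fsmN R S) (@fsm0 R S) (@fsmZ R S)
                    (@fsmM R S) (@fsm1 R S))
  /\
  (exists phi : forall S : finType, mpoly_on R S -> fsmeasure R S,
     (forall S : finType,
        is_algebra_iso (@fsmD R S) (@fsmZ R S) (@fsmM R S) (@fsm1 R S) (phi S))
     /\
     (forall (S T : finType) (f : S -> T) (p : mpoly_on R S),
        fsm_map f (phi S p) = phi T (mpoly_map f p))).
Proof.
split.
  move=> S; apply: com_algebra_of_iso (@fsm_of_mpoly_iso R S) _ _.
    exact: fsm_of_mpoly0.
  exact: fsm_of_mpolyN.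
exists (@fsm_of_mpoly R); split; first exact: fsm_of_mpoly_iso.
exact: fsm_map_of_mpoly.
Qed.
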